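(* Let $n\ge 3$ and let $f_3,\ldots,f_n:\mathbb{R}\to\mathbb{R}$ be the spline basis functions defined in the context. For $k=1,\ldots,n-2$, the function $f_{k+2}$ is even (i.e. $f_{k+2}(-x)=f_{k+2}(x)$ for all $x$) when $k-1$ is even, and odd (i.e. $f_{k+2}(-x)=-f_{k+2}(x)$ for all $x$) when $k-1$ is odd.
   Context: Let $x_i=(2i-n-1)/(n-1)$ for $i=1,\ldots,n$ (equally spaced knots in $[-1,1]$), $\mathbf{1}=(1,\ldots,1)^\top\in\mathbb{R}^n$, $\mathbf{s}=(x_1,\ldots,x_n)^\top$, and $\mathbf{X}=[\mathbf{1},\mathbf{s}]$ (an $n\times 2$ matrix). Let $\phi(r)=|r|^3$, and define the $n\times n$ matrices $$\boldsymbol{\Phi}=\bigl[\phi(x_i-x_j)\bigr]_{i,j=1}^n,\qquad \mathbf{Q}=\mathbf{I}-\mathbf{X}(\mathbf{X}^\top\mathbf{X})^{-1}\mathbf{X}^\top,\qquad \boldsymbol{\Omega}=\mathbf{Q}\boldsymbol{\Phi}\mathbf{Q}.$$ The matrix $\boldsymbol{\Omega}$ is symmetric positive semidefinite with nullity $2$, and its positive eigenvalues are simple; denote them $\lambda_1>\cdots>\lambda_{n-2}>0$, and let $\boldsymbol{\psi}_k$ be a unit eigenvector of $\boldsymbol{\Omega}$ for $\lambda_k$, so that $\boldsymbol{\Omega}=\sum_{k=1}^{n-2}\lambda_k\boldsymbol{\psi}_k\boldsymbol{\psi}_k^\top$. Define the kernel evaluation vector $\boldsymbol{\phi}(x)=(\phi(x-x_1),\ldots,\phi(x-x_n))^\top$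 for $x\in\mathbb{R}$. The spline basis $\{f_1,\ldots,f_n\}$ is given by $f_1(x)=1$, $f_2(x)=x$, and, for $k=1,\ldots,n-2$, $$f_{k+2}(x)=\lambda_k^{-1}\boldsymbol{\psi}_k^\top\left[\boldsymbol{\phi}(x)-\boldsymbol{\Phi}\mathbf{X}(\mathbf{X}^\top\mathbf{X})^{-1}\begin{bmatrix}1\\ x\end{bmatrix}\right].$$ *)

(* Defs.v *)
From HB Require Import structures.
From mathcomp Require Import all_boot all_order all_algebra.
From mathcomp Require Import reals.

Set Implicit Arguments.
Unset Strict Implicit.
Unset Printing Implicit Defensive.

Import Order.TTheory GRing.Theory Num.Theory.
Local Open Scope ring_scope.

(* Indices are 0-based: [i : 'I_n] stands for the mathematical index [i + 1],
   so [knot i] is x_(i+1) = (2 (i + 1) - n - 1) / (n - 1). *)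
Definition knot (R : realType) (n : nat) (i : 'I_n) : R :=
  (2 * i.+1%:R - n%:R - 1) / (n%:R - 1).

Definition phi (R : realType) (r : R) : R := `|r| ^+ 3.

Definition design_mx (R : realType) (n : nat) : 'M[R]_(n, 1 + 1) :=
  row_mx (const_mx 1) (\col_(i < n) knot R i).

Definition Phi_mx (R : realType) (n : nat) : 'M[R]_n :=
  \matrix_(i < n, j < n) phi (knot R i - knot R j).

(* For n >= 2 the knots are distinct, so X^T X is invertible and [invmx] is the
   genuine inverse. *)
Definition Q_mx (R : realType) (n : nat) : 'M[R]_n :=
  let X := design_mx R n in 1%:M - X *m invmx (X^T *m X) *m X^T.

Definition Omega_mx (R : realType) (n : nat) : 'M[R]_n :=
  Q_mx R n *m Phi_mx R n *m Q_mx R n.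

Definition phi_vec (R : realType) (n : nat) (x : R) : 'cV[R]_n :=
  \col_(i < n) phi (x - knot R i).

(* The basis function attached to one eigenpair (lam, psi) of Omega. *)
Definition spline_fun (R : realType) (n : nat) (lam : R) (psi : 'cV[R]_n)
    (x : R) : R :=
  let X := design_mx R n in
  lam^-1 *
  (psi^T *m (phi_vec n x -
             Phi_mx R n *m X *m invmx (X^T *m X) *m
               col_mx (const_mx 1 : 'M[R]_1) (const_mx x : 'M[R]_1)))
    ord0 ord0.

(* The functions f_3, ..., f_n: [k : 'I_(n - 2)] is the 0-based eigenpair index,
   i.e. [spline_basis lam psi k] is f_(k'+2) with k' = k + 1. *)
Definition spline_basis (R : realType) (n : nat) (lam : 'I_(n - 2) -> R)
    (psi : 'I_(n - 2) -> 'cV[R]_n) (k : 'I_(n - 2)) : R -> R :=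
  spline_fun (lam k) (psi k).

(* Main.v *)
Require Import Defs.
From HB Require Import structures.
From mathcomp Require Import all_boot all_order all_algebra.
From mathcomp Require Import reals.
From mathcomp Require Import zify ring lra.

(** The parity of a spline basis function is that of its eigenvector under
reversal of the knots ([spline_fun_mirror]), and the parity of an eigenvector can
be read off its number of sign changes. The point is thus an oscillation theorem:
the eigenvector of rank k, counted from 0, oscillates k times.

Eigenvectors of Omega with positive eigenvalue are orthogonal to the affine
functions of the knots, hence are second differences of sequences f that vanish
twice at both ends ([potential_clamped]). Taking second differences of the
eigenvalue equation kills the affine part, and since the fourth difference of the
cubic kernel is the stencil 2 (1, 4, 1), there remains the discrete clamped beam
equation G f = k T f ([potential_pencil]), where G is the fourth difference, T has
stencil (1, 4, 1), and k is inversely proportional to the eigenvalue of Omega.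

The operator G^-1 T does not increase the number of sign changes
([pencil_changes]): by the discrete Rolle theorem the first two differences of a
clamped sequence gain a sign change each, the last two lose at most one each, and T
is a product of nonnegative bidiagonal operators. The diminution is strict for a
sequence whose first free entry is zero ([pencil_changes_gain]). Three consequences
follow for eigensequences. Their extreme free entries are nonzero, so eigenspaces
are lines. They have no degenerate zeros, that is, counting sign changes with zeros
discarded or with zeros given the best signs makes no difference
([eigenseq_weak_strict]). And a larger k means strictly more sign changes
([eigenseq_changes_lt]): some combination of the two eigensequences vanishes at the
first free entry, where the diminution is strict, and the iterates of G^-1 T forwards
and backwards tend in direction to the two eigensequences.

With n - 2 different eigenvalues and n - 2 free entries the numbers of sign changes
have to be 0, 1, ..., n - 3 in order. Reflection preserves the equation, so f is even
or odd, and comparing its two extreme entries gives the sign ([eigenseq_parity]). *)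

Set Implicit Arguments.
Unset Strict Implicit.
Unset Printing Implicit Defensive.

Import Order.TTheory GRing.Theory Num.Theory.
Local Open Scope ring_scope.

(** * Alternating chains and the discrete Rolle theorem *)

Section Alternation.
Variable R : realFieldType.
Implicit Types (f g : nat -> R) (b C : bool) (L lo hi i j : nat).

(** The sign of the first entry is [(-1)^b], and with [C] zero entries count as
having either sign. The two classical numbers of sign changes, S^- (zeros discarded) and S^+ (zeros given the most
favourable signs), are one less than the largest [L] for [C = false] and for
[C = true]. Existence of chains is used instead of these numbers because each
transformation below acts on a chain entry by entry. *)
Fixpoint alternates C f b L lo hi : Prop :=
  if L is L'.+1 then
    exists2 i, (lo <= i < hi)%N &
      0 < (-1) ^+ b * f i ?<= if C /\ alternates C f (~~ b) L' i.+1 hi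
  else True.

Definition diff f i := f i.+1 - f i.

Lemma signN b (x : R) : (-1) ^+ (~~ b) * x = - ((-1) ^+ b * x).
Proof. by case: b; rewrite /= ?expr0 ?expr1; lra. Qed.

Lemma alternates_sub C f b L lo hi lo' hi' :
  (forall i, (lo <= i < hi)%N -> C || (f i != 0) -> (lo' <= i < hi')%N) ->
  alternates C f b L lo hi -> alternates C f b L lo' hi'.
Proof.
elim: L b lo lo' => [|L IH] b lo lo' //= H [i Hi [si Hs]].
exists i.
  apply: H => //; case: C {IH Hs} si => //=.
  by apply: contraTneq => ->; rewrite mulr0 ltxx.
split=> //; apply: IH Hs => j Hj Cj.
have := H j; rewrite Cj; lia.
Qed.

Lemma alternates_widen C f b L lo hi lo' hi' :
  (lo' <= lo)%N -> (hi <= hi')%N ->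
  alternates C f b L lo hi -> alternates C f b L lo' hi'.
Proof. by move=> H1 H2; apply: alternates_sub => i *; lia. Qed.

Lemma alternates_eq C f g b L lo hi :
  (forall i, (lo <= i < hi)%N -> f i = g i) ->
  alternates C f b L lo hi -> alternates C g b L lo hi.
Proof.
elim: L b lo => [|L IH] b lo //= H [i Hi [si Hs]].
exists i => //; rewrite -H //; split=> //; apply: IH Hs => j Hj.
by apply: H; lia.
Qed.

Lemma alternates_leq C f b L L' lo hi :
  (L' <= L)%N -> alternates C f b L lo hi -> alternates C f b L' lo hi.
Proof.
elim: L L' b lo => [|L IH] [|L'] b lo //= H [i Hi [si Hs]].
by exists i => //; split=> //; apply: IH Hs.
Qed.

Lemma alternates_behead C f b L lo hi :
  alternates C f b L.+1 lo hi -> alternates C f (~~ b) L lo hi.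
Proof. by move=> /= [i Hi [_]]; apply: alternates_widen; lia. Qed.

Lemma alternates_size C f b L lo hi :
  alternates C f b L lo hi -> (L <= hi - lo)%N.
Proof. by elim: L b lo => [|L IH] b lo //= [i Hi [_ /IH]]; lia. Qed.

Lemma alternates_cat C f b L1 L2 lo mid hi : (lo <= mid <= hi)%N ->
  alternates C f b L1 lo mid ->
  alternates C f (b (+) odd L1) L2 mid hi ->
  alternates C f b (L1 + L2) lo hi.
Proof.
elim: L1 b lo => [|L1 IH] b lo H /=.
  by rewrite addbF => _; apply: alternates_widen; lia.
move=> [i Hi [si Hs]] H2; exists i; first lia.
split=> //; apply: (IH _ _ _ Hs); first lia.
by move: H2; rewrite addbN addNb.
Qed.

(** When the last sign of the first chain agrees with the first sign of the second
one, dropping a single entry restores the alternation. *)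
Lemma alternates_join C f b1 b2 L1 L2 lo mid hi : (lo <= mid <= hi)%N ->
  alternates C f b1 L1 lo mid -> alternates C f b2 L2.+1 mid hi ->
  alternates C f b1 (L1 + L2) lo hi.
Proof.
move=> H H1 H2; apply: (alternates_cat H H1).
have [->|/negPf ne] := eqVneq (b1 (+) odd L1) b2.
  by apply: alternates_leq H2.
have -> : b1 (+) odd L1 = ~~ b2 by move: ne; case: (_ (+) _); case: (b2).
exact: alternates_behead.
Qed.

Lemma alternates_split C f b L lo mid hi :
  alternates C f b L lo hi ->
  exists L1 L2, [/\ L = (L1 + L2)%N, alternates C f b L1 lo mid &
    alternates C f (b (+) odd L1) L2 mid hi].
Proof.
elim: L b lo => [|L IH] b lo; first by exists 0%N, 0%N.
move=> H; have [i Hi [si Hs]] := H.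
have [ltim|leim] := ltnP i mid; last first.
  exists 0%N, L.+1; split=> //=; rewrite addbF.
  by exists i => //; lia.
have [L1 [L2 [-> H1 H2]]] := IH _ _ Hs.
exists L1.+1, L2; split => //=.
  by exists i => //; lia.
by move: H2; rewrite addbN addNb.
Qed.

Lemma alternates_skip f b L lo hi : 0 < (-1) ^+ b * f lo ->
  alternates false f (~~ b) L lo hi -> alternates false f (~~ b) L lo.+1 hi.
Proof.
case: L => [|L] //= s [i Hi [si Hs]]; exists i => //.
suff : i != lo by lia.
by apply/eqP => ei; move: si; rewrite ei signN /=; lra.
Qed.

(** A sequence that goes from a nonpositive to a nonnegative value increases
somewhere, unless it is zero at [i], [i.+1] and [j]: if it never increases,
monotonicity squeezes it to zero at these three places. Testing only [i.+1]
besides the end points is what makes the absence of two consecutive zeros a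
sufficient condition in [rolle_clamped]. *)
Lemma diff_gt0 f b i j : (i < j)%N ->
  (-1) ^+ b * f i <= 0 -> 0 <= (-1) ^+ b * f j ->
  [|| f i != 0, f i.+1 != 0 | f j != 0] ->
  exists2 k, (i <= k < j)%N & 0 < (-1) ^+ b * diff f k.
Proof.
move=> ltij si sj nz.
have [/existsP[k Hk]|] :=
  boolP [exists k : 'I_j, (i <= k)%N && (0 < (-1) ^+ b * diff f k)].
  by exists k => //; [have := ltn_ord k; lia | lia].
rewrite negb_exists => /forallP H.
have dec k : (i <= k < j)%N -> (-1) ^+ b * f k.+1 <= (-1) ^+ b * f k.
  move=> /andP[ik kj]; have := H (Ordinal kj); rewrite /= ik /= -leNgt /diff mulrBr.
  lra.
have decj k : (i <= k <= j)%N -> (-1) ^+ b * f j <= (-1) ^+ b * f k.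
  move=> /andP[ik kj]; rewrite -(subnKC kj).
  have : (k + (j - k) <= j)%N by lia.
  elim: (j - k)%N => [|d IH]; first by rewrite addn0.
  by rewrite addnS => Hd; apply: le_trans (IH _); [apply: dec; lia | lia].
have h1 := decj i.+1 ltac:(lia); have h2 := decj i ltac:(lia).
have h3 := dec i ltac:(lia).
have z k : (-1) ^+ b * f k = 0 -> f k = 0.
  by move/eqP; rewrite mulf_eq0 signr_eq0 /= => /eqP.
suff [e1 e2 e3]: [/\ f i = 0, f i.+1 = 0 & f j = 0] by move: nz; rewrite e1 e2 e3 eqxx.
by split; apply: z; lra.
Qed.

Lemma mulr_sign_neq0 b (x : R) : 0 < (-1) ^+ b * x -> x != 0.
Proof. by apply: contraTneq => ->; rewrite mulr0 ltxx. Qed.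

Lemma rolle_left f b L i hi : 0 <= (-1) ^+ b * f i ->
  alternates false f (~~ b) L i.+1 hi.+1 ->
  alternates false (diff f) (~~ b) L i hi.
Proof.
elim: L b i => [|L IH] b i //= si [j Hj [sj Hs]].
have [||||k Hk sk] := @diff_gt0 f (~~ b) i j.
- lia.
- by rewrite signN; lra.
- exact: ltW.
- by rewrite (mulr_sign_neq0 sj) !orbT.
exists k; first lia.
split=> //.
apply: (@alternates_widen _ _ _ _ j hi); [lia|lia|].
by apply: IH => //; exact: ltW.
Qed.

(** Discrete Rolle: between two consecutive entries of the chain the difference has
the sign of the later one, so differencing costs at most one entry. *)
Lemma rolle_interior f b L lo hi :
  alternates false f b L.+1 lo hi.+1 -> alternates false (diff f) (~~ b) L lo hi.
Proof.
move=> /= [i Hi [si Hs]].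
apply: (@alternates_widen _ _ _ _ i hi); [lia|lia|].
by apply: rolle_left => //; exact: ltW.
Qed.

(** A sequence that vanishes at both ends gains an entry under differencing instead
of losing one: the two zeros act as further points of the chain. A chain with
zero entries yields a genuine sign chain of differences as soon as no two
consecutive entries of the sequence vanish. *)
Lemma rolle_clamped C f b L lo hi :
  (C -> forall i, (lo <= i < hi)%N -> (f i != 0) || (f i.+1 != 0)) ->
  f lo = 0 -> f hi = 0 ->
  alternates C f b L.+1 lo.+1 hi -> alternates false (diff f) b L.+2 lo hi.
Proof.
move=> HC f0 f1.
have step (bb : bool) i j : (lo <= i < j)%N -> (j <= hi)%N ->
    (-1) ^+ bb * f i <= 0 -> 0 <= (-1) ^+ bb * f j ->
    C || (f i != 0) || (f j != 0) ->
    exists2 k, (i <= k < j)%N & 0 < (-1) ^+ bb * diff f k.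
  move=> H1 H2 si sj nz; apply: diff_gt0 => //; first lia.
  case: C HC nz => /= [/(_ isT i)|_]; last by case/orP => ->; rewrite ?orbT.
  by rewrite orbA => -> //; lia.
have nz (bb : bool) i : 0 < (-1) ^+ bb * f i ?<= if C -> C || (f i != 0).
  by case: C {HC step} => //= /mulr_sign_neq0.
have main (bb : bool) LL i : (lo < i < hi)%N -> 0 < (-1) ^+ bb * f i ?<= if C ->
    alternates C f (~~ bb) LL i.+1 hi ->
    alternates false (diff f) (~~ bb) LL.+1 i hi.
  elim: LL bb i => [|LL IH] bb i Hi si.
    move=> _ /=; have [|||||k Hk sk] := step (~~ bb) i hi.
    - lia.
    - lia.
    - by rewrite signN; move/lteifW: si; lra.
    - by rewrite f1 mulr0.
    - by rewrite (nz _ _ si).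
    by exists k; [lia|].
  case=> j Hj [sj Hs].
  have [|||||k Hk sk] := step (~~ bb) i j.
  - lia.
  - lia.
  - by rewrite signN; move/lteifW: si; lra.
  - exact: lteifW sj.
  - by rewrite (nz _ _ si).
  exists k; first lia.
  split=> //; apply: (@alternates_widen _ _ _ _ j hi); [lia|lia|].
  by apply: IH => //; lia.
case=> j Hj [sj Hs].
have [|||||k Hk sk] := step b lo j.
- lia.
- lia.
- by rewrite f0 mulr0.
- exact: lteifW sj.
- by rewrite orbAC (nz _ _ sj).
exists k; first lia.
split=> //; apply: (@alternates_widen _ _ _ _ j hi); [lia|lia|].
by apply: (main b L j).
Qed.

Lemma rolle_clamped_strict f b L lo hi : f lo = 0 -> f hi = 0 ->
  alternates false f b L.+1 lo.+1 hi -> alternates false (diff f) b L.+2 lo hi.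
Proof. by apply: rolle_clamped. Qed.

(** A positive value of [p f_i + q f_{i+1}] needs a positive value of [f] at [i] or
[i+1]. Two consecutive choices lie in windows that share at most one index, and
they cannot both pick it since they have opposite signs. *)
Lemma alternates_bidiag (p q : R) f b L lo hi : 0 <= p -> 0 <= q ->
  alternates false (fun i => p * f i + q * f i.+1) b L lo hi ->
  alternates false f b L lo hi.+1.
Proof.
move=> p0 q0; elim: L b lo => [|L IH] b lo //= [i Hi [si Hs]].
have {}Hs := IH _ _ Hs.
have [sfi|sfi] := ltP 0 ((-1) ^+ b * f i); first by exists i; [lia|].
exists i.+1; first lia.
have sfi1 : 0 < (-1) ^+ b * f i.+1.
  rewrite ltNge; apply/negP => h; move: si.
  have := mulr_ge0_le0 p0 sfi; have := mulr_ge0_le0 q0 h.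
  by rewrite mulrDr !(mulrCA ((-1) ^+ b)) /=; lra.
by split=> //; apply: alternates_skip.
Qed.

(** The number of strict sign changes can only go up under a small perturbation, and
that of weak ones can only go down; this lemma and the next one are the two
semicontinuity statements needed for the limits of the iteration in
[eigenseq_changes_lt]. *)
Lemma alternates_nearby f g b L lo hi :
  (forall i, (lo <= i < hi)%N -> f i != 0 -> `|g i - f i| < `|f i|) ->
  alternates false f b L lo hi -> alternates false g b L lo hi.
Proof.
move=> H; elim: L b lo H => [|L IH] b lo H //= [i Hi [si Hs]].
exists i => //; split; last by apply: IH Hs => j Hj; apply: H; lia.
have := H i Hi (mulr_sign_neq0 si); move: si.
have -> : `|f i| = `|(-1) ^+ b * f i| by rewrite normrM normr_sign mul1r.
have -> : `|g i - f i| = `|(-1) ^+ b * g i - (-1) ^+ b * f i|.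
  by rewrite -mulrBr normrM normr_sign mul1r.
move=> /= s; rewrite (gtr0_norm s) ltr_norml; lra.
Qed.

Lemma alternates_nearby_weak f g b L lo hi :
  (forall i, (lo <= i < hi)%N -> f i != 0 -> `|g i - f i| < `|f i|) ->
  alternates false g b L lo hi -> alternates true f b L lo hi.
Proof.
move=> H; elim: L b lo H => [|L IH] b lo H //= [i Hi [si Hs]].
exists i => //; split; last by apply: IH Hs => j Hj; apply: H; lia.
have [->|/(H i Hi)] := eqVneq (f i) 0; first by rewrite mulr0 /=.
move: si.
have -> : `|f i| = `|(-1) ^+ b * f i| by rewrite normrM normr_sign mul1r.
have -> : `|g i - f i| = `|(-1) ^+ b * g i - (-1) ^+ b * f i|.
  by rewrite -mulrBr normrM normr_sign mul1r.
move=> /= s; have [//|n] := leP 0 ((-1) ^+ b * f i).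
rewrite (ltr0_norm n) ltr_norml; lra.
Qed.

Lemma alternates_scale C (c : R) f b L lo hi : c != 0 ->
  alternates C f b L lo hi ->
  alternates C (fun i => c * f i) (b (+) (c < 0)) L lo hi.
Proof.
move=> c0; elim: L b lo => [|L IH] b lo //= [i Hi [si Hs]].
exists i => //; split; last by have := IH _ _ Hs; rewrite addNb.
have -> : (-1) ^+ (b (+) (c < 0)) * (c * f i) = `|c| * ((-1) ^+ b * f i).
  by rewrite signr_addb normrEsign -!mulrA mulrCA; congr (_ * _); rewrite mulrCA.
have cp : 0 < `|c| by rewrite normr_gt0.
by case: C si {Hs IH} => /=; rewrite ?(pmulr_rge0 _ cp) ?(pmulr_rgt0 _ cp).
Qed.

End Alternation.

(** * Sign changes under the discrete clamped beam operator *)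

Section Beam.
Variable R : realType.
Implicit Types (f g : nat -> R) (b C : bool) (L lo hi i j m : nat) (k : R).

(** Two zeros on each side, at [0], [1] and at [m+2], [m+3], are the discrete form
of clamped ends, where both the value and the slope vanish; the free entries are
those in [[2, m+2)]. *)
Definition clamped m f := forall i, (i < 2)%N || (m.+1 < i)%N -> f i = 0.

Definition diff2 f := diff (diff f).

Definition trisum f i := f i.+1 + 4 * f i.+2 + f i.+3.

(** The equation [G f = k T g] for the Gram matrix [G] of second differences, with
stencil (1, -4, 6, -4, 1), and the cubic B-spline matrix [T], with stencil
(1, 4, 1). *)
Definition pencil m k f g := forall i, (i < m)%N ->
  diff2 (diff2 f) i = k * trisum g i.

(** [L] is the number of entries of a chain, one more than the number of sign changes
that the chain exhibits. *)
Definition changes m f L := exists b, alternates false f b L 2 m.+2.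

(** The stencil (1, 4, 1) is the product of two nonnegative bidiagonal ones, because
1 + 4 z + z^2 has real negative roots; each factor cannot create sign changes. *)
Lemma alternates_trisum m f b L : clamped m f ->
  alternates false (trisum f) b L 0 m -> alternates false f b L 2 m.+2.
Proof.
move=> cf H.
(* [a] satisfies [1 + a^2 = 4 a], so that (a, 1) * (1, a) = a (1, 4, 1). *)
pose a : R := 2 - Num.sqrt 3.
have s3 : Num.sqrt (3 : R) ^+ 2 = 3 by rewrite sqr_sqrtr.
have s0 : 0 <= Num.sqrt (3 : R) by apply: sqrtr_ge0.
have a0 : 0 < a by rewrite /a; nra.
have ea : a ^+ 2 = 4 * a - 1 by rewrite /a; ring: s3.
pose x i := a * f i.+1 + 1 * f i.+2.
have {}H : alternates false (fun i => 1 * x i + a * x i.+1) b L 0 m.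
  have := alternates_scale (lt0r_neq0 a0) H.
  rewrite (le_gtF (ltW a0)) addbF; apply: alternates_eq => i _.
  by rewrite /x /trisum; ring: ea.
have {}H := alternates_bidiag ler01 (ltW a0) H.
have {}H := @alternates_bidiag _ a 1 (fun i => f i.+1) _ _ _ _ (ltW a0) ler01 H.
have : alternates false f b L 1 m.+3.
  have shift b' l lo hi : alternates false (fun i => f i.+1) b' l lo hi ->
      alternates false f b' l lo.+1 hi.+1.
    elim: l b' lo => [|l IH] b' lo //= [i Hi [si Hs]].
    by exists i.+1 => //; split=> //; apply: IH.
  exact: shift.
apply: alternates_sub => i _ /= fi; apply: contraNT fi => Hi.
by rewrite cf //; lia.
Qed.

Lemma pencil_alternates_rhs m k f g b L : 0 < k -> clamped m g -> pencil m k f g ->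
  alternates false (diff2 (diff2 f)) b L 0 m -> alternates false g b L 2 m.+2.
Proof.
move=> k0 cg E H; apply: alternates_trisum => //.
have kV : k^-1 != 0 by rewrite invr_eq0 lt0r_neq0.
have := alternates_scale kV H.
rewrite invr_lt0 (le_gtF (ltW k0)) addbF; apply: alternates_eq => i Hi.
by rewrite E // mulKf // lt0r_neq0.
Qed.

Lemma pencil_alternates m k f g b L : 0 < k -> clamped m g -> pencil m k f g ->
  alternates false (diff2 f) b L.+2 0 m.+2 -> alternates false g b L 2 m.+2.
Proof.
move=> k0 cg E /rolle_interior/rolle_interior; rewrite negbK.
exact: (pencil_alternates_rhs k0 cg E).
Qed.

(** A zero of the second difference at the left end serves as one more point for
the third difference, which saves one of the two entries lost in [pencil_alternates]. *)
Lemma pencil_alternates0 m k f g b L : 0 < k -> clamped m g -> pencil m k f g ->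
  diff2 f 0 = 0 ->
  alternates false (diff2 f) b L.+1 0 m.+2 -> alternates false g (~~ b) L 2 m.+2.
Proof.
move=> k0 cg E f0 H.
have {}H : alternates false (diff2 f) (~~ ~~ b) L.+1 1 m.+2.
  rewrite negbK; apply: alternates_sub H => i Hi /= fi.
  suff : i != 0%N by lia.
  by apply: contraNneq fi => ->; rewrite f0.
have {}H : alternates false (diff (diff2 f)) b L.+1 0 m.+1.
  by rewrite -[b]negbK; apply: rolle_left => //; rewrite f0 mulr0.
exact: (pencil_alternates_rhs k0 cg E (rolle_interior H)).
Qed.

Lemma clamped_diff2 m f b L : clamped m f ->
  alternates false f b L.+1 2 m.+2 -> alternates false (diff2 f) b L.+3 0 m.+2.
Proof.
move=> cf H.
apply: rolle_clamped_strict; rewrite ?/diff ?cf ?subrr //; try lia.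
by apply: rolle_clamped_strict => //; rewrite cf //; lia.
Qed.

(** Variation diminishing property of [G^-1 T], which sends [g] to a multiple of [f]:
the two inner differences gain an entry each thanks to the clamped ends, the two
outer ones lose an entry each, and [T] does not gain any. *)
Lemma pencil_changes m k f g L : 0 < k -> clamped m f -> clamped m g ->
  pencil m k f g -> changes m f L.+1 -> changes m g L.+1.
Proof.
move=> k0 cf cg E [b H]; exists b; apply: (pencil_alternates k0 cg E).
exact: clamped_diff2.
Qed.

(** If the first free entry vanishes, the second difference starts with a zero, and the
diminution is strict ([pencil_alternates0]). *)
Lemma pencil_changes_gain m k f g L : 0 < k -> clamped m f -> clamped m g ->
  pencil m k f g -> f 2%N = 0 -> changes m f L.+1 -> changes m g L.+2.
Proof.
move=> k0 cf cg E f2 [b H]; exists (~~ b); apply: (pencil_alternates0 k0 cg E).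
  by rewrite /diff2 /diff f2 !cf //; lra.
exact: clamped_diff2.
Qed.

Definition eigenseq m k f :=
  [/\ 0 < k, clamped m f, pencil m k f f & exists i, f i != 0].

Lemma nonzero_changes m f : clamped m f -> (exists i, f i != 0) -> changes m f 1.
Proof.
move=> cf [i fi]; exists (f i < 0); exists i.
  apply: contraR fi => Hi; rewrite cf //; lia.
by split=> //=; rewrite -normrEsign normr_gt0.
Qed.

(** There are only [m] free entries, so a property that makes chains grow by one is
absurd for a nonzero sequence. *)
Lemma changes_bounded m f : clamped m f -> (exists i, f i != 0) ->
  ~ (forall L, changes m f L.+1 -> changes m f L.+2).
Proof.
move=> cf nz H.
have : changes m f m.+1.
  elim: m.+1 => [|L IH]; first by exists true.
  by case: L IH => [|L] IH; [exact: nonzero_changes | apply: H].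
by case=> b /alternates_size; lia.
Qed.

Lemma eigenseq_first_neq0 m k f : eigenseq m k f -> f 2%N != 0.
Proof.
case=> k0 cf E nz; apply/eqP => f2; apply: (changes_bounded cf nz) => L.
exact: (pencil_changes_gain k0 cf cf E f2).
Qed.

Definition mirror m f i := if (i <= m.+3)%N then f (m.+3 - i)%N else 0.

Lemma clamped_mirror m f : clamped m f -> clamped m (mirror m f).
Proof.
by move=> cf i Hi; rewrite /mirror; case: ifP => // Hi2; apply: cf; lia.
Qed.

Lemma eigenseq_mirror m k f : eigenseq m k f -> eigenseq m k (mirror m f).
Proof.
case=> k0 cf E [i0 fi0]; split => //; first exact: clamped_mirror.
- move=> i Hi; have := E (m.-1 - i)%N ltac:(lia).
  have mir j : (j <= m.+3)%N -> mirror m f j = f (m.+3 - j)%N by rewrite /mirror => ->.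
  rewrite /diff2 /diff /trisum !mir; [|lia..].
  have e0 : (m.+3 - i = (m.-1 - i).+4)%N by lia.
  have e1 : (m.+3 - i.+1 = (m.-1 - i).+3)%N by lia.
  have e2 : (m.+3 - i.+2 = (m.-1 - i).+2)%N by lia.
  have e3 : (m.+3 - i.+3 = (m.-1 - i).+1)%N by lia.
  have e4 : (m.+3 - i.+4 = (m.-1 - i))%N by lia.
  rewrite e0 e1 e2 e3 e4; lra.
- have lei0 : (i0 <= m.+3)%N by apply: contraR fi0 => far; rewrite cf //; lia.
  by exists (m.+3 - i0)%N; rewrite /mirror ifT ?subKn //; lia.
Qed.

Lemma eigenseq_last_neq0 m k f : eigenseq m k f -> f m.+1 != 0.
Proof.
move/eigenseq_mirror/eigenseq_first_neq0.
by have -> : m.+1 = (m.+3 - 2)%N by lia.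
Qed.

(** Two adjacent zeros inside cut the sequence into two pieces that are clamped at
the cut too. The second difference of each piece has two more chain entries than
the piece, and at most one entry is lost where the pieces meet, so an eigensequence
would have more sign changes than itself. *)
Lemma eigenseq_no_double_zero m k f i : eigenseq m k f -> (0 < i < m.+2)%N ->
  (f i != 0) || (f i.+1 != 0).
Proof.
move=> Ef Hi; apply/norP => -[/negPn/eqP fp /negPn/eqP fp1].
have f2 := eigenseq_first_neq0 Ef; have fm := eigenseq_last_neq0 Ef.
case: Ef => k0 cf E nz.
have i1 : i != 1%N by apply: contraNneq f2 => <-; rewrite fp1.
have i2 : i != 2%N by apply: contraNneq f2 => <-; rewrite fp.
have im : i != m by apply: contraNneq fm => <-; rewrite fp1.
have im1 : i != m.+1 by apply: contraNneq fm => <-; rewrite fp.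
apply: (changes_bounded cf nz) => L [b H].
have [L1 [L2 [eL Hl Hr]]] := alternates_split i H.
(* A piece that contributes no entry to [H] still has a one-entry chain, at the
   nonzero extreme entry of [f]. *)
have {Hl} [b1 Hl] : exists b1, alternates false f b1 L1.-1.+1 2 i.
  case: L1 {eL Hr} Hl => [_|L1 Hl]; last by exists b.
  exists (f 2%N < 0), 2%N; first lia.
  by split=> //=; rewrite -normrEsign normr_gt0.
have {Hr} [b2 Hr] : exists b2, alternates false f b2 L2.-1.+1 i.+2 m.+2.
  case: L2 {eL} Hr => [_|L2 Hr].
    exists (f m.+1 < 0), m.+1; first lia.
    by split=> //=; rewrite -normrEsign normr_gt0.
  exists (b (+) odd L1); apply: alternates_sub Hr => j Hj /= fj.
  have ji : j != i by apply: contraNneq fj => ->; rewrite fp.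
  have ji1 : j != i.+1 by apply: contraNneq fj => ->; rewrite fp1.
  lia.
have d0 : diff f 0 = 0 by rewrite /diff !cf ?subrr.
have di : diff f i = 0 by rewrite /diff fp fp1 subrr.
have dm : diff f m.+2 = 0 by rewrite /diff !cf ?subrr //; lia.
have f1 : f 1%N = 0 by rewrite cf.
have fm2 : f m.+2 = 0 by rewrite cf //; lia.
have {}Hl := rolle_clamped_strict d0 di (rolle_clamped_strict f1 fp Hl).
have {}Hr := rolle_clamped_strict di dm (rolle_clamped_strict fp1 fm2 Hr).
have := alternates_join _ Hl Hr; move=> /(_ ltac:(lia)) HH.
exists b1; apply: (pencil_alternates k0 cf E); apply: alternates_leq HH; lia.
Qed.

(** A weak chain without two consecutive zeros becomes a strict one after the first
difference ([rolle_clamped]), and the equation brings it back as a strict chain of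
the original length: S^+ = S^- on eigensequences. *)
Lemma eigenseq_weak_strict m k f b L : eigenseq m k f ->
  alternates true f b L.+1 2 m.+2 -> alternates false f b L.+1 2 m.+2.
Proof.
move=> Ef H; have nd := eigenseq_no_double_zero Ef; case: Ef => k0 cf E nz.
apply: (pencil_alternates k0 cf E).
apply: rolle_clamped_strict; rewrite ?/diff ?cf ?subrr //; try lia.
apply: (@rolle_clamped _ true) => //; try (by rewrite cf //; lia).
Qed.

Lemma small_multiple f g n :
  exists2 d : R, 0 < d & forall s, `|s| < d -> forall i, (i < n)%N ->
    f i != 0 -> `|s * g i| < `|f i|.
Proof.
elim: n => [|n [d d0 IH]]; first by exists 1.
have [fn|fn] := eqVneq (f n) 0.
  exists d => // s sd i; rewrite ltnS leq_eqVlt => /orP[/eqP->|]; last exact: IH.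
  by rewrite fn eqxx.
have gp : 0 < `|g n| + 1 by have := normr_ge0 (g n); lra.
exists (Num.min d (`|f n| / (`|g n| + 1))).
  by rewrite lt_min d0 divr_gt0 // normr_gt0.
move=> s; rewrite lt_min => /andP[sd sf] i.
rewrite ltnS leq_eqVlt => /orP[/eqP-> _|]; last exact: IH.
rewrite normrM; rewrite ltr_pdivlMr // in sf.
by apply: le_lt_trans sf; rewrite ler_wpM2l // lerDl.
Qed.

Lemma expr_unbounded (rho M : R) : 1 < rho -> exists N, M < rho ^+ N.
Proof.
move=> r1.
have bern N : 1 + N%:R * (rho - 1) <= rho ^+ N.
  elim: N => [|N IH]; first by rewrite expr0; lra.
  have : 0 <= (rho - 1) * (rho ^+ N - 1).
    by rewrite mulr_ge0 // subr_ge0 ?exprn_ege1 ?(ltW r1).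
  rewrite exprS -natr1; lra.
have [N HN] : exists N, M / (rho - 1) < N%:R.
  have [M0|M0] := leP 0 (M / (rho - 1)); last by exists 0%N.
  by exists (Num.bound (M / (rho - 1))); apply: archi_boundP.
exists N; apply: lt_le_trans (bern N).
by move: HN; rewrite ltr_pdivrMr; lra.
Qed.

Lemma expr_small (rho t d : R) : 1 < rho -> 0 < d ->
  exists N, `|t| / rho ^+ N < d.
Proof.
move=> r1 d0; have [N HN] := expr_unbounded (`|t| / d) r1.
exists N; have rp : 0 < rho ^+ N by rewrite exprn_gt0 //; lra.
by rewrite ltr_pdivrMr // mulrC -ltr_pdivrMr.
Qed.

(** Strict growth of the number of sign changes with [k]. On the combinations
[f + s g] the operator [G^-1 T] multiplies [s] by [k1 / k2 < 1] up to a factor, so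
sign changes do not decrease when [s] is multiplied by [rho = k2 / k1]. Choose [t]
such that [f + t g] vanishes at the first free entry. Multiplying [s] by [rho] again
and again leads from a neighbourhood of [f] to [f + t g], then with a strict gain
to [f + t rho g], and on to a neighbourhood of the line of [g]. *)
Lemma eigenseq_changes_lt m k1 k2 f g L : eigenseq m k1 f -> eigenseq m k2 g ->
  k1 < k2 -> changes m f L.+1 -> changes m g L.+2.
Proof.
move=> Ef Eg k12 Hf.
have f2 := eigenseq_first_neq0 Ef; have g2 := eigenseq_first_neq0 Eg.
have wsg := @eigenseq_weak_strict _ _ _ _ L.+1 Eg.
case: Ef Eg => k10 cf Ef _ [k20 cg Eg _].
pose rho := k2 / k1; have r1 : 1 < rho by rewrite /rho ltr_pdivlMr // mul1r.
pose comb s i := f i + s * g i.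
have cc s : clamped m (comb s) by move=> i Hi; rewrite /comb cf // cg // mulr0 addr0.
have E s : pencil m k1 (comb s) (comb (s * rho)).
  move=> i Hi; have := Ef i Hi; have := Eg i Hi.
  rewrite /diff2 /diff /trisum /comb.
  have -> : k2 = k1 * rho by rewrite /rho mulrC divfK // lt0r_neq0.
  by move=> /(congr1 ( *%R s)) /= eg ef; lra.
have iter N s l : changes m (comb s) l.+1 -> changes m (comb (s * rho ^+ N)) l.+1.
  move=> H; elim: N => [|N IH]; first by rewrite expr0 mulr1.
  rewrite exprSr mulrA; exact: (pencil_changes k10 (cc _) (cc _) (E _)).
pose t := - f 2%N / g 2%N.
have t0 : t != 0 by rewrite mulf_neq0 ?oppr_eq0 ?invr_eq0.
have ct : comb t 2%N = 0 by rewrite /comb /t; field.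
have rp N : rho ^+ N != 0 by rewrite expf_neq0 //; lra.
(* [comb (t / rho ^+ N)] is close to [f]. *)
have Ht : changes m (comb t) L.+1.
  have [d d0 Hd] := small_multiple f g m.+2.
  have [N HN] := expr_small t r1 d0.
  have -> : t = t / rho ^+ N * rho ^+ N by rewrite divfK.
  apply: iter; case: Hf => b Hb; exists b.
  apply: alternates_nearby Hb => i Hi fi.
  rewrite /comb addrC addKr; apply: Hd => //; last lia.
  by rewrite normrM normfV (ger0_norm (exprn_ge0 _ _)) //; lra.
have {}Ht := pencil_changes_gain k10 (cc _) (cc _) (E _) ct Ht.
(* [comb (t * rho * rho ^+ N)], divided by its coefficient of [g], is close to [g]. *)
have [d d0 Hd] := small_multiple g f m.+2.
have [N HN] := expr_small t^-1 r1 d0.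
have [b Hb] := iter N _ _ Ht.
set s := t * rho * rho ^+ N in Hb.
have s0 : s != 0 by do 2!(apply: mulf_neq0 => //); apply: lt0r_neq0; lra.
have := alternates_scale (invr_neq0 s0) Hb; set b' := (_ (+) _) => Hb'.
exists b'; apply: wsg; apply: alternates_nearby_weak Hb' => i Hi gi.
have -> : s^-1 * comb s i - g i = s^-1 * f i by rewrite /comb; field.
apply: Hd => //; last lia.
apply: le_lt_trans HN.
have r0 : 0 < rho by lra.
rewrite (_ : s^-1 = t^-1 / rho ^+ N * rho^-1); last by rewrite /s !invfM mulrAC.
rewrite !normrM [`|rho^-1|]gtr0_norm ?invr_gt0 // [`|(rho ^+ N)^-1|]gtr0_norm.
  by rewrite ler_piMr ?invf_le1 ?(ltW r1) // divr_ge0 // exprn_ge0 // ltW.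
by rewrite invr_gt0 exprn_gt0.
Qed.

(** Otherwise a combination of the two would be an eigensequence that vanishes at the
first free entry. *)
Lemma eigenseq_proportional m k f g i : eigenseq m k f -> eigenseq m k g ->
  g i * f 2%N = f i * g 2%N.
Proof.
move=> [k0 cf Ef _] [_ cg Eg _].
apply/eqP; rewrite -subr_eq0; apply/negPn/negP => nz.
pose h j := g j * f 2%N - f j * g 2%N.
suff /eigenseq_first_neq0 : eigenseq m k h by rewrite /h mulrC subrr eqxx.
split=> //; last by exists i.
  by move=> j Hj; rewrite /h (cf j Hj) (cg j Hj) !mul0r subrr.
move=> j Hj; have := Ef j Hj; have := Eg j Hj.
rewrite /h /diff2 /diff /trisum => eg ef.
have := congr1 ( *%R^~ (f 2%N)) eg; have := congr1 ( *%R^~ (g 2%N)) ef => /=; lra.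
Qed.

(** With [m] different eigenvalues and at most [m - 1] sign changes available, the
strict growth forces the eigensequence of rank [j] to have exactly [j] sign
changes. The extreme free entries have the signs of the first and last entries of
a maximal chain, since otherwise they would prolong it; so their ratio has the sign
of [(-1)^j]. The mirror image is a multiple of the sequence, that ratio is the
factor, and it is 1 in absolute value because mirroring twice is the identity. *)
Theorem eigenseq_parity m (k : nat -> R) (f : nat -> nat -> R) :
  (forall j, (j < m)%N -> eigenseq m (k j) (f j)) ->
  (forall i j, (i < j < m)%N -> k i < k j) ->
  forall j i, (j < m)%N -> (i <= m.+3)%N ->
  f j (m.+3 - i)%N = (-1) ^+ j * f j i.
Proof.
move=> Ef kinc j i jm im.
have lower l : (l < m)%N -> changes m (f l) l.+1.
  elim: l => [|l IH] lm; first by case: (Ef 0%N lm) => _ cf _; apply: nonzero_changes.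
  by apply: (eigenseq_changes_lt (Ef l _) (Ef _ lm)); [lia | apply: kinc; lia | apply: IH; lia].
have upper : ~ changes m (f j) j.+2.
  move=> H.
  have up d : (j + d < m)%N -> changes m (f (j + d)%N) (j + d).+2.
    elim: d => [|d IH] Hd; first by rewrite addn0.
    rewrite addnS; rewrite addnS in Hd.
    apply: (eigenseq_changes_lt (Ef (j + d)%N _) (Ef _ Hd));
      [lia | apply: kinc; lia | apply: IH; lia].
  have [b /alternates_size] := up (m.-1 - j)%N ltac:(lia); lia.
have Fj := Ef j jm; have f2 := eigenseq_first_neq0 Fj.
have fm := eigenseq_last_neq0 Fj.
have [b Hb] := lower j jm.
have pos (c : bool) (x : R) : x != 0 -> ~ 0 < (-1) ^+ (~~ c) * x -> 0 < (-1) ^+ c * x.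
  move=> x0 h; rewrite lt_neqAle eq_sym mulf_neq0 ?signr_eq0 //=.
  by rewrite leNgt -oppr_gt0 -signN; apply/negP.
have sfirst : 0 < (-1) ^+ b * f j 2%N.
  apply: pos => // s; apply: upper; exists (~~ b), 2%N; first lia.
  by split => //; apply: alternates_skip; rewrite // negbK.
have slast : 0 < (-1) ^+ (b (+) odd j) * f j m.+1.
  have [L1 [L2 [eL Hl Hr]]] := alternates_split m.+1 Hb.
  case: L2 eL Hr => [|L2] eL Hr; last first.
    have eL2 : L2 = 0%N by have := alternates_size Hr; lia.
    have -> : odd j = odd L1 by congr odd; lia.
    case: Hr => x Hx [sx _].
    by have <- : x = m.+1 by lia.
  apply: pos => // s; apply: upper; exists b.
  have -> : j.+2 = (L1 + 1)%N by lia.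
  apply: (alternates_cat _ Hl); first lia.
  exists m.+1; first lia.
  split=> //; move: s; rewrite -addbN; congr (0 < (-1) ^+ nat_of_bool (_ (+) _) * _).
  have -> : L1 = j.+1 by lia.
  by [].
have prop x := eigenseq_proportional x Fj (eigenseq_mirror Fj).
have mir x : (x <= m.+3)%N -> mirror m (f j) x = f j (m.+3 - x)%N by rewrite /mirror => ->.
have last : mirror m (f j) 2 = f j m.+1 by rewrite mir //; congr f; lia.
have first : mirror m (f j) m.+1 = f j 2%N by rewrite mir; [congr f; lia|lia].
have := prop i; rewrite -mir // last.
have := prop m.+1; rewrite last first => sq.
have -> : f j m.+1 = (-1) ^+ j * f j 2%N.
  have : (f j 2%N - f j m.+1) * (f j 2%N + f j m.+1) = 0 by lra.
  move: sfirst slast; rewrite -[(-1) ^+ j]signr_odd; case: b {Hb}; case: (odd j);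
    rewrite /= ?expr0 ?expr1 => s1 s2 /eqP; rewrite mulf_eq0 => /orP[]/eqP; lra.
by move=> e; apply: (mulIf f2); rewrite e; ring.
Qed.

End Beam.

(** * From eigenvectors of Omega to eigensequences *)

Section SplineMatrices.
Variables (R : realType) (m : nat).
Local Notation n := m.+2.
Local Notation X := (design_mx R n).
Local Notation kn := (@knot R n).

Definition knot_step : R := 2 / m.+1%:R.

Lemma knot_step_gt0 : 0 < knot_step. Proof. by rewrite divr_gt0. Qed.

Lemma knotE (i : 'I_n) : kn i = knot_step * i%:R - 1.
Proof.
have m0 : 0 <= m%:R :> R by [].
by rewrite /knot /knot_step -!natr1; field; apply: lt0r_neq0; lra.
Qed.

Lemma knot_rev (i : 'I_n) : kn (rev_ord i) = - kn i.
Proof.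
rewrite !knotE /= subSS natrB; last by have := ltn_ord i; lia.
have m0 : 0 <= m%:R :> R by [].
by rewrite /knot_step -!natr1; field; apply: lt0r_neq0; lra.
Qed.

Lemma phiN (r : R) : phi (- r) = phi r.
Proof. by rewrite /phi normrN. Qed.

Lemma phi_knot (i j : 'I_n) :
  phi (kn i - kn j) = knot_step ^+ 3 * `|i%:R - j%:R| ^+ 3.
Proof.
rewrite /phi !knotE (_ : _ - _ = knot_step * (i%:R - j%:R)); last by ring.
by rewrite normrM (gtr0_norm knot_step_gt0) exprMn.
Qed.

Lemma sum_rev (F : 'I_n -> R) (e : R) :
  (forall i, F (rev_ord i) = e * F i) -> \sum_i F i = e * \sum_i F i.
Proof.
move=> H; rewrite {1}(reindex_inj rev_ord_inj) mulr_sumr.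
by apply: eq_bigr => i _; exact: H.
Qed.

Definition ones : 'cV[R]_n := const_mx 1.
Definition knots : 'cV[R]_n := \col_i kn i.

Lemma gram_offdiag : ones^T *m knots = 0 /\ knots^T *m ones = 0.
Proof.
have s0 : \sum_i kn i = 0.
  by have := @sum_rev kn (-1) (fun i => etrans (knot_rev i) (esym (mulN1r _))); lra.
split; apply/matrixP => i j; rewrite !mxE -[RHS]s0; apply: eq_bigr => l _;
  by rewrite !mxE ?mul1r ?mulr1.
Qed.

Lemma gramE : X^T *m X = block_mx (ones^T *m ones) 0 0 (knots^T *m knots).
Proof.
have [e1 e2] := gram_offdiag.
by rewrite /design_mx tr_row_mx mul_col_row -/ones -/knots e1 e2.
Qed.

Lemma sqnorm_unit (v : 'cV[R]_n) i : v i 0 != 0 -> v^T *m v \in unitmx.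
Proof.
move=> vi; rewrite unitmxE det_mx11 unitfE mxE.
apply: lt0r_neq0; rewrite (bigD1 i) //= ltr_wpDr //.
  by apply: sumr_ge0 => j _; rewrite mxE -expr2 sqr_ge0.
by rewrite mxE -expr2 exprn_even_gt0.
Qed.

Lemma ones_unit : ones^T *m ones \in unitmx.
Proof. by apply: (@sqnorm_unit _ ord0); rewrite mxE oner_neq0. Qed.

Lemma knots_unit : knots^T *m knots \in unitmx.
Proof.
apply: (@sqnorm_unit _ ord0); rewrite mxE knotE mulr0 sub0r.
by rewrite oppr_eq0 oner_neq0.
Qed.

Lemma gram_unit : X^T *m X \in unitmx.
Proof.
rewrite gramE unitmxE det_ublock unitrM -!unitmxE.
by rewrite ones_unit knots_unit.
Qed.

Section Eigen.
Variable psi : 'cV[R]_n.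

(** The double sum of [psi]. The truncated subtraction makes the weight of [psi j] the
discrete ramp that is zero for [i <= j + 1]. *)
Definition potential i : R := \sum_(j < n) (i - j.+1)%:R * psi j 0.

Lemma potential_diff2 (i : 'I_n) : diff2 potential i = psi i 0.
Proof.
rewrite /diff2 /diff /potential -!sumrB (bigD1 i) //= big1 ?addr0.
  have [-> -> ->] : [/\ i.+2 - i.+1 = 1, i.+1 - i.+1 = 0 & i - i.+1 = 0]%N by split; lia.
  by ring.
move=> j /eqP nij; have {}nij : (i <> j :> nat) by move=> e; apply: nij; apply: val_inj.
have [ij|ij] := ltnP i j.
  have [-> -> ->] : [/\ i.+2 - j.+1 = 0, i.+1 - j.+1 = 0 & i - j.+1 = 0]%N by split; lia.
  by ring.
have [-> ->] : (i.+2 - j.+1 = (i - j.+1).+2 /\ i.+1 - j.+1 = (i - j.+1).+1)%N by split; lia.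
by rewrite -!natr1; ring.
Qed.

Variable lam : R.
Hypothesis lam0 : 0 < lam.
Hypothesis psiE : Omega_mx R n *m psi = lam *: psi.

Lemma eigen_orthogonal : X^T *m psi = 0.
Proof.
have XQ : X^T *m Q_mx R n = 0.
  by rewrite /Q_mx mulmxBr mulmx1 !mulmxA mulmxV ?gram_unit // mul1mx subrr.
have : lam *: (X^T *m psi) = 0.
  by rewrite scalemxAr -psiE /Omega_mx !mulmxA XQ !mul0mx.
by move/eqP; rewrite scaler_eq0 (gt_eqF lam0) => /eqP.
Qed.

Lemma eigen_affine : exists c : 'cV[R]_(1 + 1),
  lam *: psi = Phi_mx R n *m psi - X *m c.
Proof.
have Qpsi : Q_mx R n *m psi = psi.
  by rewrite /Q_mx mulmxBl mul1mx -!mulmxA eigen_orthogonal !mulmx0 subr0.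
exists (invmx (X^T *m X) *m (X^T *m (Phi_mx R n *m psi))).
rewrite -psiE /Omega_mx -mulmxA Qpsi -mulmxA {1}/Q_mx mulmxBl mul1mx.
by rewrite !mulmxA.
Qed.

Lemma eigen_moments :
  \sum_i psi i 0 = 0 /\ \sum_(i < n) i%:R * psi i 0 = 0.
Proof.
have := eigen_orthogonal; rewrite /design_mx tr_row_mx mul_col_mx.
rewrite -(@col_mx0 R 1 1 1) => /eq_col_mx[/matrixP/(_ 0 0) e0 /matrixP/(_ 0 0) e1].
have s0 : \sum_i psi i 0 = 0.
  by move: e0; rewrite !mxE => e0; rewrite -[RHS]e0; apply: eq_bigr => i _; rewrite !mxE mul1r.
split=> //.
have : knot_step * (\sum_(i < n) i%:R * psi i 0) - \sum_i psi i 0 = 0.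
  move: e1; rewrite !mxE => e1; rewrite -[RHS]e1 mulr_sumr -sumrB.
  by apply: eq_bigr => i _; rewrite !mxE knotE; ring.
by rewrite s0 subr0 => /eqP; rewrite mulf_eq0 (gt_eqF knot_step_gt0) => /eqP.
Qed.

(** Beyond the last knot the ramps are affine in [j], and [psi] is orthogonal to affine
functions of the knots. *)
Lemma potential_clamped : clamped m potential.
Proof.
move=> i /orP[i2|im]; rewrite /potential.
  by rewrite big1 // => j _; rewrite (_ : (i - j.+1 = 0)%N) ?mul0r //; lia.
have [s0 s1] := eigen_moments.
rewrite (eq_bigr (fun j : 'I_n => (i%:R - 1) * psi j 0 - j%:R * psi j 0)).
  by rewrite sumrB -mulr_sumr s0 s1 mulr0 subr0.
by move=> j _; rewrite natrB ?(leq_trans (ltn_ord j)) // -natr1; ring.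
Qed.

(** Up to an affine function of [j], the second difference of the cubic kernel is
the stencil (1, 4, 1) applied to ramps: the fourth difference of |r|^3 is
2 (1, 4, 1). *)
Lemma cubic_diff2 (i j : nat) :
  `|i%:R - j%:R| ^+ 3 - 2 * `|i.+1%:R - j%:R| ^+ 3 + `|i.+2%:R - j%:R| ^+ 3 =
  2 * ((i.+1 - j.+1)%:R + 4 * (i.+2 - j.+1)%:R + (i.+3 - j.+1)%:R)
  - 6 * (i.+1%:R - j%:R) :> R.
Proof.
have [ji|ij] := leqP j i.
  rewrite -(subnKC ji); set d := (i - j)%N.
  have -> : ((j + d).+1 - j.+1 = d)%N by lia.
  have -> : ((j + d).+2 - j.+1 = d.+1)%N by lia.
  have -> : ((j + d).+3 - j.+1 = d.+2)%N by lia.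
  rewrite -!natr1 natrD.
  have d0 : 0 <= d%:R :> R by [].
  rewrite !ger0_norm; [ring|lra..].
have [->|ne] := eqVneq j i.+1.
  have -> : (i.+1 - i.+2 = 0)%N by lia.
  have -> : (i.+2 - i.+2 = 0)%N by lia.
  have -> : (i.+3 - i.+2 = 1)%N by lia.
  rewrite subrr normr0 distrC -!natr1.
  rewrite !ger0_norm; [ring|lra..].
have le2 : (i.+2 <= j)%N by lia.
rewrite -(subnKC le2); set d := (j - i.+2)%N.
have -> : (i.+1 - (i.+2 + d).+1 = 0)%N by lia.
have -> : (i.+2 - (i.+2 + d).+1 = 0)%N by lia.
have -> : (i.+3 - (i.+2 + d).+1 = 0)%N by lia.
rewrite natrD -!natr1.
have d0 : 0 <= d%:R :> R by [].
rewrite !ler0_norm; [ring|lra..].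
Qed.

(** The second difference of the eigenvalue equation: the affine part removed by the
projection Q disappears, and [cubic_diff2] turns the kernel sum into [trisum]. *)
Lemma potential_pencil :
  pencil m (2 * knot_step ^+ 3 / lam) potential potential.
Proof.
move=> i Hi.
have [c Hc] := eigen_affine.
have row (l : 'I_n) : lam * psi l 0 =
    \sum_j phi (kn l - kn j) * psi j 0 - (c (lshift 1 0) 0 + kn l * c (rshift 1 0) 0).
  have /matrixP/(_ l 0) := Hc; rewrite !mxE => ->.
  rewrite big_split_ord !big_ord1 /= /design_mx row_mxEl row_mxEr !mxE mul1r.
  by congr (_ - _); apply: eq_bigr => j _; rewrite mxE.
have Hi0 : (i < n)%N by lia.
have Hi1 : (i.+1 < n)%N by lia.
have Hi2 : (i.+2 < n)%N by lia.
have := row (Ordinal Hi0); have := row (Ordinal Hi1); have := row (Ordinal Hi2).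
rewrite -!potential_diff2 /=.
have lamN0 : lam != 0 by rewrite lt0r_neq0.
have [s0 s1] := eigen_moments.
have ker : \sum_j phi (kn (Ordinal Hi0) - kn j) * psi j 0
    - 2 * \sum_j phi (kn (Ordinal Hi1) - kn j) * psi j 0
    + \sum_j phi (kn (Ordinal Hi2) - kn j) * psi j 0
    = 2 * knot_step ^+ 3 * trisum potential i.
  have tri : trisum potential i = \sum_(j < n)
      ((i.+1 - j.+1)%:R + 4 * (i.+2 - j.+1)%:R + (i.+3 - j.+1)%:R) * psi j 0.
    rewrite /trisum /potential mulr_sumr -!big_split /=.
    by apply: eq_bigr => j _; ring.
  have aff : \sum_(j < n) (i.+1%:R - j%:R) * psi j 0 = 0.
    rewrite (eq_bigr (fun j : 'I_n => i.+1%:R * psi j 0 - j%:R * psi j 0)).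
      by rewrite sumrB -mulr_sumr s0 s1 mulr0 subr0.
    by move=> j _; rewrite mulrBl.
  rewrite -[RHS]subr0 -[Z in _ = _ - Z](mulr0 (6 * knot_step ^+ 3)).
  rewrite -[Z in _ = _ - _ * Z]aff tri !mulr_sumr -!sumrB -big_split /=.
  apply: eq_bigr => j _; rewrite !phi_knot /=.
  rewrite -[LHS]/(_ + _) [LHS](_ : _ = knot_step ^+ 3 * psi j 0 * (`|i%:R - j%:R| ^+ 3
    - 2 * `|i.+1%:R - j%:R| ^+ 3 + `|i.+2%:R - j%:R| ^+ 3)); last by ring.
  by rewrite cubic_diff2; ring.
move: ker; set S0 := \sum_j _; set S1 := \sum_j _; set S2 := \sum_j _.
rewrite !knotE /= => ker e2 e1 e0.
apply: (mulfI lamN0).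
have -> : lam * (2 * knot_step ^+ 3 / lam * trisum potential i) =
    2 * knot_step ^+ 3 * trisum potential i by field.
rewrite -ker [diff2 (diff2 _) _](_ : _ = diff2 potential i.+2 - 2 * diff2 potential i.+1
  + diff2 potential i); last by rewrite {1}/diff2 /diff -/(diff2 potential); ring.
move: e0 e1 e2; rewrite -!natr1; lra.
Qed.

Lemma potential_eigenseq : psi != 0 ->
  eigenseq m (2 * knot_step ^+ 3 / lam) potential.
Proof.
move=> psi0; split.
- by rewrite divr_gt0 // mulr_gt0 // exprn_gt0 // knot_step_gt0.
- exact: potential_clamped.
- exact: potential_pencil.
- have [i psii] : exists i, psi i 0 != 0.
    apply/existsP; apply: contraNT psi0; rewrite negb_exists => /forallP H.
    by apply/eqP/matrixP => i j; rewrite ord1 mxE; apply/eqP/negPn/H.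
  have [f0|f0] := eqVneq (potential i) 0; last by exists i.
  have [f1|f1] := eqVneq (potential i.+1) 0; last by exists i.+1.
  exists i.+2; move: psii; rewrite -potential_diff2 /diff2 /diff f0 f1.
  by rewrite !subr0.
Qed.

End Eigen.

Lemma potential_mirror_psi (psi : 'cV[R]_n) (e : R) :
  (forall i, (i <= m.+3)%N -> potential psi (m.+3 - i)%N = e * potential psi i) ->
  forall i, psi (rev_ord i) 0 = e * psi i 0.
Proof.
move=> H i; rewrite -!potential_diff2 /diff2 /diff /=.
have li := ltn_ord i.
have := H i ltac:(lia); have := H i.+1 ltac:(lia); have := H i.+2 ltac:(lia).
have -> : (m.+3 - i = (m.+2 - i.+1).+2)%N by lia.
have -> : (m.+3 - i.+1 = (m.+2 - i.+1).+1)%N by lia.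
have -> : (m.+3 - i.+2 = m.+2 - i.+1)%N by lia.
move=> -> -> ->; ring.
Qed.

(** Reflection of the knots exchanges the entries of [psi^T phi(x)] and of [psi^T Phi]
symmetrically. In [1, s] the first column is even, the second is odd, and the Gram
matrix is block diagonal, so only the part of the affine correction with the parity
of [psi] survives. *)
Lemma spline_fun_mirror (lam : R) (psi : 'cV[R]_n) (e : R) (x : R) :
  e = 1 \/ e = -1 ->
  (forall i, psi (rev_ord i) 0 = e * psi i 0) ->
  spline_fun lam psi (- x) = e * spline_fun lam psi x.
Proof.
move=> e1 psi_rev.
have phi_rev : (psi^T *m phi_vec n (- x)) 0 0 = e * (psi^T *m phi_vec n x) 0 0.
  rewrite !mxE (reindex_inj rev_ord_inj) mulr_sumr; apply: eq_bigr => i _.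
  by rewrite !mxE psi_rev knot_rev -opprB phiN mulrA; congr (_ * phi _); ring.
pose a := psi^T *m Phi_mx R n.
have a_rev i : a 0 (rev_ord i) = e * a 0 i.
  rewrite !mxE (reindex_inj rev_ord_inj) mulr_sumr; apply: eq_bigr => j _.
  rewrite !mxE psi_rev !knot_rev mulrA -[in RHS]phiN; congr (_ * phi _); ring.
have a1 : a *m ones = e *: (a *m ones).
  apply/matrixP => i j; rewrite !ord1 !mxE; apply: sum_rev => l.
  by rewrite a_rev !mxE mulrA.
have ak : a *m knots = - e *: (a *m knots).
  apply/matrixP => i j; rewrite !ord1 !mxE; apply: sum_rev => l.
  by rewrite a_rev !mxE knot_rev; ring.
have affE y : psi^T *m (Phi_mx R n *m X *m invmx (X^T *m X) *m
      col_mx (const_mx 1 : 'M[R]_1) (const_mx y : 'M[R]_1)) =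
    a *m ones *m invmx (ones^T *m ones) *m (const_mx 1 : 'M[R]_1)
    + y *: (a *m knots *m invmx (knots^T *m knots) *m (const_mx 1 : 'M[R]_1)).
  rewrite gramE invmx_block_diag -?gramE ?gram_unit // !mulmxA -/a.
  rewrite [a *m X]mul_mx_row mul_row_block !mulmx0 addr0 add0r mul_row_col.
  by congr (_ + _); rewrite scalemxAr scalemx_const mulr1.
rewrite /spline_fun !mulmxBr !affE.
move: (a *m ones) (a *m knots) a1 ak => u v a1 ak.
move: phi_rev; set p := psi^T *m phi_vec n (- x); set q := psi^T *m phi_vec n x => pq.
set u' := u *m _ *m _; set v' := v *m _ *m _.
have eu : u' 0 0 = e * u' 0 0 by rewrite /u' {1}a1 -!scalemxAl mxE.
have ev : v' 0 0 = - e * v' 0 0 by rewrite /v' {1}ak -!scalemxAl mxE.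
rewrite [RHS]mulrCA mxE [p _ _]pq; congr (_ * _).
clearbody u' v' q; rewrite !mxE.
have parts (A B D : R) : B = e * B -> D = - e * D ->
    e * A - (B + - x * D) = e * (A - (B + x * D)).
  case: e1 => -> hB hD; first have -> : D = 0 by lra.
    by ring.
  have -> : B = 0 by lra.
  by ring.
exact: parts.
Qed.

End SplineMatrices.

(** * Parity of the spline basis *)

Theorem theorem4p1 (R : realType) (n : nat) (hn : (3 <= n)%N)
    (lam : 'I_(n - 2) -> R) (psi : 'I_(n - 2) -> 'cV[R]_n)
    (lam_decr : forall i j : 'I_(n - 2), (i < j)%N -> lam j < lam i)
    (lam_gt0 : forall k : 'I_(n - 2), 0 < lam k)
    (psi_eigen : forall k : 'I_(n - 2),
        Omega_mx R n *m psi k = lam k *: psi k)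
    (psi_unit : forall k : 'I_(n - 2), \sum_(i < n) (psi k i ord0) ^+ 2 = 1)
    (k : 'I_(n - 2)) :
  (~~ odd k -> forall x : R,
      spline_basis lam psi k (- x) = spline_basis lam psi k x) /\
  (odd k -> forall x : R,
      spline_basis lam psi k (- x) = - spline_basis lam psi k x).
Proof.
case: n hn lam psi lam_decr lam_gt0 psi_eigen psi_unit k => [|[|m]] // _.
move=> lam psi lam_decr lam_gt0 psi_eigen psi_unit k.
have psi0 l : psi l != 0.
  apply/eqP => p0; have := psi_unit l.
  rewrite big1 => [|i _]; last by rewrite p0 mxE expr0n.
  by move/eqP; rewrite eq_sym oner_eq0.
have em : (m.+2 - 2 = m)%N by rewrite subn2.
have km : (k < m)%N by rewrite -[X in (_ < X)%N]em.
(* Eigenpairs indexed by all naturals; the default value [k] is never reached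
   below [m]. *)
pose o (j : nat) : 'I_(m.+2 - 2) := insubd k j.
have oE j : (j < m)%N -> o j = j :> nat by move=> jm; rewrite /o val_insubd ifT // em.
have := @eigenseq_parity R m (fun j => 2 * knot_step R m ^+ 3 / lam (o j))
  (fun j => potential (psi (o j))) _ _ k _ km.
have -> : o k = k by apply: val_inj; rewrite /= oE.
move=> par.
have psi_rev : forall i, psi k (rev_ord i) 0 = (-1) ^+ k * psi k i 0.
  apply: potential_mirror_psi => i; apply: par => // [j _|i' j /andP[ij jm]].
    exact: potential_eigenseq.
  rewrite /= ltr_pM2l; last by rewrite mulr_gt0 // exprn_gt0 // knot_step_gt0.
  rewrite ltf_pV2 ?posrE //.
  by apply: lam_decr; rewrite !oE // (ltn_trans ij).
have e1 : (-1) ^+ k = 1 :> R \/ (-1) ^+ k = -1 :> R.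
  by rewrite -signr_odd; case: (odd k); [right|left].
split=> ok x; rewrite /spline_basis (spline_fun_mirror (lam k) x e1 psi_rev).
  by rewrite -signr_odd (negPf ok) mul1r.
by rewrite -signr_odd ok mulN1r.
Qed.
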